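(* Let $u\in\ell(\Lambda)$. If $u$ is implementable via $(p,h)$ for some walk inflow rates $h\in\Lambda$ and nonnegative tolls $p:H\to\mathbb{R}_+^E$, then the master problem $$\inf_{h'}\ \sum_{w\in\mathcal{W}}\int_H \Psi_w(u,\cdot)\,h'_w\,\mathrm{d}\sigma\quad\text{s.t.}\quad \ell^u(h')\le u,\ \ h'\in\Lambda^u$$ admits an optimal solution $h'$ for which the inequality is tight, i.e. $\ell^u(h')=u$.
   Context: Setting. $G=(V,E)$ is a finite directed graph; $\delta^+(v),\delta^-(v)$ denote the edges leaving/entering $v$. Time horizons $H'=[0,t_f']\subsetneq H=[0,t_f]$; $\sigma$ is Lebesgue measure on $H$; $L(H)$, $L_+(H)$ are (nonnegative) integrable functions on $H$. A walk is a finite tuple of edges $(e_1,\dots,e_k)$ with $e_j=(v_j,v_{j+1})$ (repeated edges and cycles allowed); $w[j]$ is its $j$-th edge and $|w|$ its length. There is a finite set $I$ of commodities; commodity $i$ has source $s_i$, destination $d_i$ (reachable from $s_i$), value-of-time $\gamma_i>0$ and inflow rate $r_i\in L_+(H)\setminus\{0\}$. $\mathcal{W}_i$ is the set of pairs $(\hat w,i)$ with $\hat w$ an $s_i$–$d_i$ walk, $\mathcal{W}=\bigcup_i\mathcal{W}_i$. Traversal times: every edge flow $g\in L_+(H)^E$ induces functions $D_e(g,\cdot):H\to\mathbb{R}_+$ (depending only on $g_e$); $T_e(g,t)=t+D_e(g,t)$; for a walk $w$, $A_{w,1}(g,\cdot)=\mathrm{id}$ and $A_{w,j}(g,\cdot)=T_{w[j-1]}(g,\cdot)\circ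 A_{w,j-1}(g,\cdot)$ for $2\le j\le |w|+1$. An edge flow $g$ is induced by a walk flow $h\in L_+(H)^{\mathcal W}$ if for all $e\in E$, $t\in H$: $\int_0^t g_e\,\mathrm d\sigma=\sum_{w\in\mathcal W}\sum_{j:w[j]=e}\int_{A_{w,j}(g,\cdot)^{-1}([0,t])}h_w\,\mathrm d\sigma$. $\Lambda$ is the set of $h\in L_+(H)^{\mathcal W}$ with $\sum_{w}\|h_w\|_{L^1}<\infty$, $\sum_{w\in\mathcal W_i}h_w=r_i$ for all $i$, for which this equation has a solution supported on $H'$; a fixed network loading map $\ell:\Lambda\to L_+(H)^E$ assigns to each $h$ such a solution. For $u\in L_+(H)^E$, the parameterized travel times are $D^u(g,t):=D(u,t)$ for all $g$; $\Lambda^u$ and $\ell^u$ are defined exactly as $\Lambda,\ell$ but with $D^u$ in place of $D$ (so all arrival times $A_{w,j}(u,\cdot)$ are fixed by $u$). Standing assumptions: (1) there is $\tau^{\min}>0$ such that for all $g\in L_+(H)^E$, $e\in E$: $D_e(g,\cdot)$ is absolutely continuous and $T_e(g,\cdot)$ is nondecreasing; $D_e(g,t)\ge\tau^{\min}$ for $t\in H'$; and there is $g_e^-\in L_+(H)$ with $\int_{T_e(g,\cdot)^{-1}([0,t])}g_e\,\mathrm d\sigma=\int_0^tg_e^-\,\mathrm d\sigma$ for all $t\in H$. (2) There is $\tau^{\max}>0$ with $D_e(g,t)\le\tau^{\max}$ for $t\in H'$, $g\in\ell(\Lambda)$. (3) $A_{w,j}(g,\cdot)(H)\subseteq H$ for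 all $g\in\ell(\Lambda)$, $w\in\mathcal W$, $j\le|w|+1$. (4) For every $u\in L_+(H)^E$ supported on $H'$ and $h\in\Lambda^u$: $\ell^u(h)=u$ implies $\ell(h)=u$. Costs: $\Psi_{(\hat w,i)}(g,t)=\gamma_i\,(A_{w,|w|+1}(g,t)-t)$. For tolls $p:H\to\mathbb R_+^E$, $P^p_w(g,t)=\sum_{j\le|w|}p_{w[j]}(A_{w,j}(g,t))$. A $p$-dynamic user equilibrium ($p$-DUE) is $h\in\Lambda$ with $g=\ell(h)$ such that for all $i$, $w\in\mathcal W_i$ and a.e. $t$: $h_w(t)>0$ implies $\Psi_w(g,t)+P^p_w(g,t)\le\Psi_{w'}(g,t)+P^p_{w'}(g,t)$ for all $w'\in\mathcal W_i$. A vector $g$ is implementable via $(p,h)$ if $h\in\Lambda$ is a $p$-DUE with $\ell(h)=g$ and $\langle p,g\rangle:=\sum_e\int_H p_eg_e\,\mathrm d\sigma<\infty$. *)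

(* Defs.v *)
From HB Require Import structures.
From mathcomp Require Import all_boot all_order all_algebra.
From mathcomp Require Import all_classical all_reals all_analysis.
Set Implicit Arguments.
Unset Strict Implicit.
Unset Printing Implicit Defensive.
Import Order.TTheory GRing.Theory Num.Theory.
Import numFieldNormedType.Exports.
Local Open Scope classical_set_scope.
Local Open Scope ring_scope.

(* Walk indices (pairs (w,i)) are elements of  seq E * I ;  the set
   W of admissible ones is  Wset N  below.  A walk flow is a function
   seq E * I -> R -> R (only its values on W and on H matter); an edge
   flow is a function E -> R -> R.                                     *)
Record model (R : realType) := Model {
  V : finType;
  E : finType;
  etail : E -> V;
  ehead : E -> V;
  I : finType;              (* commodities *)
  src : I -> V;
  dst : I -> V;
  gam : I -> R;             (* value of time gamma_i *)
  rate : I -> R -> R;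
  tf : R;
  tf' : R;
  D : (E -> R -> R) -> E -> R -> R;
  ell : (seq E * I -> R -> R) -> E -> R -> R;
  ellu : (E -> R -> R) -> (seq E * I -> R -> R) -> E -> R -> R
}.

Arguments etail {R} N _ : rename.
Arguments ehead {R} N _ : rename.
Arguments src {R} N _ : rename.
Arguments dst {R} N _ : rename.
Arguments gam {R} N _ : rename.
Arguments rate {R} N _ _ : rename.
Arguments tf {R} N : rename.
Arguments tf' {R} N : rename.
Arguments D {R} N _ _ _ : rename.
Arguments ell {R} N _ _ _ : rename.
Arguments ellu {R} N _ _ _ _ : rename.

Unset Implicit Arguments.
Section Defs.
Context {R : realType} (N : model R).
Local Notation mu := (@lebesgue_measure R).
Local Notation E := (E N).
Local Notation I := (I N).
Local Notation W := (seq E * I)%type.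

Definition Hs : set R := `[0, tf N].
Definition Hs' : set R := `[0, tf' N].
Definition Iv (t : R) : set R := `[0, t].

Definition isLp (f : R -> R) : Prop :=
  (forall t, Hs t -> 0 <= f t) /\ mu.-integrable Hs (EFin \o f).

Definition edgeflow (g : E -> R -> R) : Prop := forall e, isLp (g e).

Definition aeeq (f f' : R -> R) : Prop := {ae mu, forall t, Hs t -> f t = f' t}.

Definition supported (g : E -> R -> R) : Prop :=
  forall e, {ae mu, forall t, Hs t -> ~ Hs' t -> g e t = 0}.

Fixpoint walk_from (v : V N) (w : seq E) : option (V N) :=
  match w with
  | [::] => Some v
  | e :: w' => if etail N e == v then walk_from (ehead N e) w' else None
  end.
Definition sd_walk (s d : V N) (w : seq E) : Prop := walk_from s w = Some d.

Definition Wset : set W := [set wi | sd_walk (src N wi.2) (dst N wi.2) wi.1].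

Definition Tt (g : E -> R -> R) (e : E) (t : R) : R := t + D N g e t.

(* arrival times: arr Tf w k = A_{w,k+1}  (so arr Tf w 0 = id and
   arr Tf w (size w) = A_{w,|w|+1}) *)
Definition arr (Tf : E -> R -> R) (w : seq E) (k : nat) (t : R) : R :=
  foldl (fun s e => Tf e s) t (take k w).

(* "g is induced by h" for the traversal times Tf (= T(g) for the
   original model, = T(u) for the parameterized model D^u) *)
Definition induced (Tf : E -> R -> R) (g : E -> R -> R) (h : W -> R -> R) : Prop :=
  forall e t, Hs t ->
    (\int[mu]_(x in Iv t) (g e x)%:E =
     \esum_(w in Wset)
        \sum_(k < size w.1 | nth e w.1 k == e)
           \int[mu]_(x in [set x | Hs x /\ (0 <= arr Tf w.1 k x <= t)%R]) (h w x)%:E)%E.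

Definition LambdaGen (Tof : (E -> R -> R) -> E -> R -> R) (h : W -> R -> R) : Prop :=
  [/\ (forall w, Wset w -> isLp (h w)),
      (\esum_(w in Wset) \int[mu]_(x in Hs) (h w x)%:E < +oo)%E,
      (forall i, {ae mu, forall t, Hs t ->
          (\esum_(w in [set w | Wset w /\ w.2 = i]) (h w t)%:E = (rate N i t)%:E)%E}) &
      exists g, [/\ edgeflow g, supported g & induced (Tof g) g h]].

Definition Lambda (h : W -> R -> R) : Prop := LambdaGen Tt h.
Definition Lambdau (u : E -> R -> R) (h : W -> R -> R) : Prop :=
  LambdaGen (fun _ => Tt u) h.

Definition abs_cont_on (a b : R) (f : R -> R) : Prop :=
  forall eps : R, 0 < eps -> exists2 delta : R, 0 < delta &
    forall (n : nat) (x y : 'I_n -> R),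
      (forall i, a <= x i /\ x i <= y i /\ y i <= b) ->
      (forall i j, i != j -> y i <= x j \/ y j <= x i) ->
      \sum_(i < n) (y i - x i) < delta ->
      \sum_(i < n) `|f (y i) - f (x i)| < eps.

Definition Psi (g : E -> R -> R) (w : W) (t : R) : R :=
  gam N w.2 * (arr (Tt g) w.1 (size w.1) t - t).

Fixpoint tollsum (Tf : E -> R -> R) (p : E -> R -> R) (w : seq E) (t : R) : R :=
  match w with
  | [::] => 0
  | e :: w' => p e t + tollsum Tf p w' (Tf e t)
  end.
(* P^p_w(g,t) = sum_j p_{w[j]}(A_{w,j}(g,t)) *)
Definition Ptoll (p : E -> R -> R) (g : E -> R -> R) (w : W) (t : R) : R :=
  tollsum (Tt g) p w.1 t.

Definition DUE (p : E -> R -> R) (h : W -> R -> R) : Prop :=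
  Lambda h /\
  forall w, Wset w -> {ae mu, forall t, Hs t -> 0 < h w t ->
     forall w', Wset w' -> w'.2 = w.2 ->
       Psi (ell N h) w t + Ptoll p (ell N h) w t
         <= Psi (ell N h) w' t + Ptoll p (ell N h) w' t}.

Definition pairing_finite (p g : E -> R -> R) : Prop :=
  (\sum_(e : E) \int[mu]_(t in Hs) (p e t * g e t)%R%:E < +oo)%E.

Definition implementable (g p : E -> R -> R) (h : W -> R -> R) : Prop :=
  [/\ DUE p h, (forall e, aeeq (ell N h e) (g e)) & pairing_finite p g].

Definition tolls (p : E -> R -> R) : Prop :=
  forall e, measurable_fun Hs (p e) /\ forall t, Hs t -> 0 <= p e t.

Definition master_feasible (u : E -> R -> R) (h : W -> R -> R) : Prop :=
  Lambdau u h /\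
  forall e, {ae mu, forall t, Hs t -> ellu N u h e t <= u e t}.

Definition master_obj (u : E -> R -> R) (h : W -> R -> R) : \bar R :=
  (\esum_(w in Wset) \int[mu]_(t in Hs) (Psi u w t * h w t)%R%:E)%E.

Definition setting : Prop :=
  [/\ injective (fun e : E => (etail N e, ehead N e)),
      0 <= tf' N /\ tf' N < tf N,
      (forall i, 0 < gam N i),
      (forall i, isLp (rate N i) /\ ~ aeeq (rate N i) (fun _ => 0)) &
      (forall i, exists w, sd_walk (src N i) (dst N i) w)].

Definition well_defined : Prop :=
  [/\ (forall g e t, edgeflow g -> Hs t -> 0 <= D N g e t),
      (forall g g' e, edgeflow g -> edgeflow g' -> aeeq (g e) (g' e) ->
          forall t, Hs t -> D N g e t = D N g' e t),
      (forall h, Lambda h ->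
          [/\ edgeflow (ell N h), supported (ell N h) & induced (Tt (ell N h)) (ell N h) h]) &
      (forall u h, edgeflow u -> Lambdau u h ->
          [/\ edgeflow (ellu N u h), supported (ellu N u h) & induced (Tt u) (ellu N u h) h])].

Definition assumption1 : Prop :=
  exists2 taumin : R, 0 < taumin &
    forall g e, edgeflow g ->
      [/\ abs_cont_on 0 (tf N) (D N g e),
          {in Hs &, {homo Tt g e : x y / x <= y}},
          (forall t, Hs' t -> taumin <= D N g e t) &
          exists gm, isLp gm /\ forall t, Hs t ->
            (\int[mu]_(x in [set x | Hs x /\ (0 <= Tt g e x <= t)%R]) (g e x)%:E
               = \int[mu]_(x in Iv t) (gm x)%:E)%E].

Definition assumption2 : Prop :=
  exists2 taumax : R, 0 < taumax &
    forall h e t, Lambda h -> Hs' t -> D N (ell N h) e t <= taumax.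

Definition assumption3 : Prop :=
  forall h w k t, Lambda h -> Wset w -> (k <= size w.1)%N -> Hs t ->
    Hs (arr (Tt (ell N h)) w.1 k t).

Definition assumption4 : Prop :=
  forall u h, edgeflow u -> supported u -> Lambdau u h ->
    (forall e, aeeq (ellu N u h e) (u e)) -> forall e, aeeq (ell N h e) (u e).

Definition standing_assumptions : Prop :=
  [/\ assumption1, assumption2, assumption3 & assumption4].

End Defs.

(* Main.v *)
(* The equilibrium flow [h] is itself an optimal solution. An edge flow induced
   by a walk flow is the density of the sum of the images of the walk inflows
   under the arrival times, so it is determined up to null sets (whence
   [ellu u h = u]), and integrating the tolls against it gives the total toll
   paid along the walks: sum_w int P_w h_w = <p, g>. At almost every departure
   time the equilibrium uses only walks of minimal [Psi + P], so it minimises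
   the total of travel cost and tolls among all flows with the same inflow
   rates. A feasible flow induces at most [u], hence pays at most <p, u> in
   tolls, which is what [h] pays; as <p, u> is finite it can be cancelled. *)
Require Import Defs.
From HB Require Import structures.
From mathcomp Require Import all_boot all_order all_algebra.
From mathcomp Require Import all_classical all_reals all_analysis.
From mathcomp Require Import measurable_realfun.
Import Order.TTheory GRing.Theory Num.Theory.
Import numFieldNormedType.Exports.
Import HBNNSimple.
Local Open Scope classical_set_scope.
Local Open Scope ring_scope.

(** * Measures and countable sums *)

(** Induction along the construction of the integral: a nonnegative simple function is a finite sum
    of scaled indicators of its fibres, and a nonnegative measurable function is an increasing limit
    of simple ones. *)
Lemma ge0_measurable_fun_ind {d} {T : measurableType d} {R : realType}
    (P : (T -> \bar R) -> Prop) :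
  (forall A, measurable A -> P (fun x => (\1_A x)%:E)) ->
  (forall (c : R) (f : T -> \bar R), (0 <= c)%R -> measurable_fun setT f ->
    (forall x, 0 <= f x)%E -> P f -> P (fun x => c%:E * f x)%E) ->
  (forall f g : T -> \bar R, measurable_fun setT f -> (forall x, 0 <= f x)%E ->
    measurable_fun setT g -> (forall x, 0 <= g x)%E ->
    P f -> P g -> P (fun x => f x + g x)%E) ->
  (forall f : (T -> \bar R)^nat, (forall n, measurable_fun setT (f n)) ->
    (forall n x, 0 <= f n x)%E -> (forall x, nondecreasing_seq (f ^~ x)) ->
    (forall n, P (f n)) -> P (fun x => limn (f ^~ x))) ->
  forall f, measurable_fun setT f -> (forall x, 0 <= f x)%E -> P f.
Proof.
move=> Pindic Pscale Padd Plim.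
have Psimple (f : {nnsfun T >-> R}) : P (fun x => (f x)%:E).
  pose g y x := (y * \1_(f @^-1` [set y]) x)%:E.
  have fE x : (f x)%:E = (\sum_(y <- finmap.enum_fset (fset_set (range f))) g y x)%E.
    by rewrite fimfunE -fsumEFin// fsbig_finite.
  have g0 y x : (0 <= g y x)%E by rewrite /g EFinM nnfun_muleindic_ge0.
  have mg y : measurable_fun setT (g y).
    by apply/measurable_EFinP; exact: measurable_funM.
  have Pg y : P (g y).
    (* For negative [y] the scaling rule does not apply, but the fibre is empty and [g y] is the
       indicator of [set0]. *)
    have [y0|y0] := leP 0%R y.
      apply: (Pscale _ (fun x => (\1_(f @^-1` [set y]) x)%:E)) => //.
      - exact/measurable_EFinP.
      - exact: Pindic.
    have -> : g y = (fun x => (\1_set0 x)%:E).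
      by apply/funext => x; rewrite /g preimage_nnfun0// indic0 mulr0.
    exact: Pindic.
  have Psum s : P (fun x => \sum_(y <- s) g y x)%E.
    elim: s => [|y s ih].
      rewrite (_ : (fun _ => _) = (fun x => (\1_set0 x)%:E)); first exact: Pindic.
      by apply/funext => x; rewrite big_nil indic0.
    rewrite (_ : (fun _ => _) = (fun x => g y x + \sum_(z <- s) g z x)%E); last first.
      by apply/funext => x; rewrite big_cons.
    apply: Padd => //; first exact: emeasurable_sum.
    by move=> x; exact: sume_ge0.
  by rewrite (funext fE).
move=> f mf f0; pose f_ := nnsfun_approx measurableT mf.
have -> : f = fun x => limn (fun n => (f_ n x)%:E).
  by apply/funext => x; apply/esym/cvg_lim => //; exact: cvg_nnsfun_approx.
apply: (Plim (fun n x => (f_ n x)%:E)) => //.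
- by move=> n; exact/measurable_EFinP.
- by move=> n x; rewrite lee_fin.
- by move=> x m n mn; rewrite lee_fin; exact/lefP/nd_nnsfun_approx.
Qed.

(** [nu] is the image under [phi] of the measure with density [f] on [D]. Its countable additivity
    is the exchange of integral and series of nonnegative terms; the change of variables then
    extends from indicators by induction on [q]. *)
Lemma weighted_pushforward {d1 d2} {T1 : measurableType d1}
    {T2 : measurableType d2} {R : realType} (mu : {measure set T1 -> \bar R})
    (D : set T1) (phi : T1 -> T2) (f : T1 -> R) :
  measurable D -> measurable_fun D phi -> measurable_fun D f ->
  (forall x, D x -> 0 <= f x) ->
  exists nu : {measure set T2 -> \bar R}, forall q : T2 -> \bar R,
    measurable_fun setT q -> (forall x, 0 <= q x)%E ->
    (\int[nu]_x q x = \int[mu]_(x in D) (q (phi x) * (f x)%:E))%E.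
Proof.
move=> mD mphi mf f0.
have mq (q : T2 -> \bar R) : measurable_fun setT q ->
    measurable_fun D (fun x => q (phi x) * (f x)%:E)%E.
  move=> mq; apply: emeasurable_funM; last exact/measurable_EFinP.
  exact: measurableT_comp.
have q0 (q : T2 -> \bar R) : (forall x, 0 <= q x)%E ->
    forall x, D x -> (0 <= q (phi x) * (f x)%:E)%E.
  by move=> q0 x Dx; rewrite mule_ge0// lee_fin f0.
pose m A := (\int[mu]_(x in D) ((\1_A (phi x))%:E * (f x)%:E))%E.
have m0 : m set0 = 0%E.
  by rewrite /m integral0_eq// => x Dx; rewrite indic0 mul0e.
have m_ge0 A : (0 <= m A)%E.
  by apply: integral_ge0 => x Dx; apply: (q0 (fun x => (\1_A x)%:E)) => // y; rewrite lee_fin.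
pose ind (A : set T2) (x : T2) : \bar R := (\1_A x)%:E.
have ind0 A x : (0 <= ind A x)%E by rewrite lee_fin.
have mind A : measurable A -> measurable_fun setT (ind A).
  by move=> mA; exact/measurable_EFinP.
have m_sigma : semi_sigma_additive m.
  move=> F mF tF mUF.
  have -> : m (\bigcup_n F n) = (\sum_(n <oo) m (F n))%E.
    rewrite /m -integral_nneseries//.
    - apply: eq_integral => x /[!inE] Dx.
      under eq_eseriesr do rewrite muleC.
      rewrite nneseriesZl; last by move=> n _; rewrite lee_fin.
      by rewrite muleC indic_bigcup.
    - by move=> n; exact: (mq _ (mind _ (mF n))).
    - by move=> n; exact: (q0 _ (ind0 (F n))).
  by apply: is_cvg_nneseries => n _ _; exact: m_ge0.
pose nu : {measure set T2 -> \bar R} :=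
  HB.pack m (isMeasure.Build _ _ _ m m0 m_ge0 m_sigma).
exists nu; apply: ge0_measurable_fun_ind.
- by move=> A mA; rewrite integral_indic// setIT.
- move=> c q c0 mq' q0' IH; rewrite ge0_integralZl// IH -ge0_integralZl//.
  + by apply: eq_integral => x _; rewrite muleA.
  + exact: mq.
  + exact: q0.
- move=> q q' mq1 q1 mq2 q2 IH1 IH2; rewrite ge0_integralD// IH1 IH2 -ge0_integralD//.
  + by apply: eq_integral => x _; rewrite ge0_muleDl.
  + exact: q0.
  + exact: mq.
  + exact: q0.
  + exact: mq.
- move=> F mF F0 ndF IH; rewrite monotone_convergence//.
  rewrite (_ : (fun n => _) = (fun n => \int[mu]_(x in D) (F n (phi x) * (f x)%:E)))%E; last first.
    by apply/funext.
  rewrite -monotone_convergence//.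
  + apply: eq_integral => x /[!inE] Dx; apply/cvg_lim => //.
    apply: cvgeZr => //; exact/ereal_nondecreasing_is_cvgn.
  + by move=> n; exact: mq.
  + by move=> n; exact: q0.
  + by move=> x Dx i j ij; rewrite lee_wpmul2r ?lee_fin ?f0//; exact: ndF.
Qed.

(** Brings the theory of series to bear on sums over a countable set: [pickle] enumerates the
    indices, and numbers that code no element of [S] contribute 0. *)
Lemma esum_nneseries {R : realType} {T : countType} (S : set T)
    (a : T -> \bar R) : (forall i, S i -> (0 <= a i)%E) ->
  (\esum_(i in S) a i = \sum_(n <oo)
    oapp (fun i => if i \in S then a i else 0) 0 (pickle_inv n))%E.
Proof.
move=> a0; have b0 i : (0 <= (if i \in S then a i else 0))%E.
  by case: ifPn => // /[!inE]; exact: a0.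
rewrite nneseries_esumT; last by move=> n; case: pickle_inv => /=.
rewrite esum_mkcond.
rewrite (eq_esum (b := fun i : T => oapp (fun i => if i \in S then a i else 0%E) 0%E
    (pickle_inv (pickle i)))); last by move=> i _; rewrite pickleK_inv.
rewrite -(esum_image setT (@pickle T)
  (fun n => oapp (fun i => if i \in S then a i else 0%E) 0%E (pickle_inv n))); last first.
  by move=> i j _ _ /(pcan_inj pickleK).
rewrite esum_mkcond; apply: eq_esum => n _; case: ifPn => // /negP nT.
case E : (pickle_inv n) => [i|//]; case: nT; rewrite inE; exists i => //.
by have := @pickle_invK T n; rewrite E.
Qed.

Lemma integral_esum {d} {X : measurableType d} {R : realType}
    (mu : {measure set X -> \bar R}) {T : countType} (S : set T)
    (D : set X) (f : T -> X -> \bar R) : measurable D ->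
  (forall i, S i -> measurable_fun D (f i)) ->
  (forall i x, S i -> D x -> (0 <= f i x)%E) ->
  (\int[mu]_(x in D) (\esum_(i in S) f i x) =
   \esum_(i in S) \int[mu]_(x in D) f i x)%E.
Proof.
move=> mD mf f0; rewrite esum_nneseries; last first.
  by move=> i Si; apply: integral_ge0 => x; exact: f0.
pose g n x := oapp (fun i => if i \in S then f i x else 0%E) 0%E (pickle_inv n).
transitivity (\int[mu]_(x in D) (\sum_(n <oo) g n x))%E.
  apply: eq_integral => x /[!inE] Dx; rewrite esum_nneseries// => i Si.
  exact: f0.
rewrite integral_nneseries//.
- apply: eq_eseriesr => n _; rewrite /g; case: pickle_inv => /= [i|]; last first.
    by rewrite integral0.
  by case: (i \in S) => //; rewrite integral0.
- move=> n; rewrite /g; case: pickle_inv => [i|] /=; last exact: measurable_cst.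
  have [|_] := boolP (i \in S); last exact: measurable_cst.
  by rewrite inE => /mf.
- move=> n x Dx; rewrite /g; case: pickle_inv => [i|] //=.
  by case: ifPn => // /[!inE] Si; exact: f0.
Qed.

(** The weighted images of the individual indices are added up as a series of measures, with the
    zero measure for indices outside [S]. *)
Lemma weighted_pushforward_esum {d1 d2} {T1 : measurableType d1}
    {T2 : measurableType d2} {R : realType} (mu : {measure set T1 -> \bar R})
    {J : countType} (S : set J) (D : set T1) (phi : J -> T1 -> T2)
    (f : J -> T1 -> R) : measurable D ->
  (forall j, S j -> measurable_fun D (phi j)) ->
  (forall j, S j -> measurable_fun D (f j)) ->
  (forall j x, S j -> D x -> 0 <= f j x) ->
  exists nu : {measure set T2 -> \bar R}, forall q : T2 -> \bar R,
    measurable_fun setT q -> (forall x, 0 <= q x)%E ->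
    (\int[nu]_x q x =
     \esum_(j in S) \int[mu]_(x in D) (q (phi j x) * (f j x)%:E))%E.
Proof.
move=> mD mphi mf f0.
have /choice[nu nuE] j : exists nu : {measure set T2 -> \bar R}, S j ->
    forall q : T2 -> \bar R, measurable_fun setT q -> (forall x, 0 <= q x)%E ->
    (\int[nu]_x q x = \int[mu]_(x in D) (q (phi j x) * (f j x)%:E))%E.
  have [Sj|nSj] := pselect (S j); last by exists mzero.
  have [nu nuE] := weighted_pushforward mu D (phi j) (f j) mD
    (mphi j Sj) (mf j Sj) (fun x => f0 j x Sj).
  by exists nu => _; exact: nuE.
pose m n : {measure set T2 -> \bar R} :=
  oapp (fun j => if j \in S then nu j else mzero) mzero (pickle_inv n).
exists (mseries m 0) => q mq q0; rewrite ge0_integral_measure_series//.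
rewrite esum_nneseries; last first.
  move=> j Sj; apply: integral_ge0 => x Dx.
  by rewrite mule_ge0// lee_fin f0.
apply: eq_eseriesr => n _; rewrite /m; case: pickle_inv => [j|] /=; last first.
  exact: integral_measure_zero.
case: ifPn => [/[!inE] Sj|_]; first exact: nuE.
exact: integral_measure_zero.
Qed.

(** The rays []-oo, t]] are closed under intersection, generate the Borel sets, and exhaust the line
    by sets of finite measure, so the two measures coincide. *)
Lemma eq_integral_cumulative {R : realType} (m1 m2 : {measure set R -> \bar R}) :
  (forall t, m1 `]-oo, t]%classic = m2 `]-oo, t]%classic) ->
  (forall t, (m1 `]-oo, t]%classic < +oo)%E) ->
  forall q : R -> \bar R, (\int[m1]_x q x = \int[m2]_x q x)%E.
Proof.
move=> m12 m1y q; apply: eq_measure_integral => A mA _.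
pose G : set (set R) := range (fun t => `]-oo, t]%classic).
have GE : @measurable _ R = <<s G >>.
  rewrite [LHS](RGenOInfty.measurableE R).
  rewrite eqEsubset; split; apply: smallest_sub; try exact: smallest_sigma_algebra.
    move=> _ [x ->]; rewrite -setCitvl; apply: sigma_algebraC.
    by apply: sub_sigma_algebra; exists x.
  move=> _ [x _ <-]; rewrite -setCitvr; apply: sigma_algebraC.
  by apply: sub_sigma_algebra; exists x.
apply: (measure_unique G (fun n : nat => `]-oo, n%:R]%classic)) => //.
- move=> _ _ [s _ <-] [t _ <-]; exists (Num.min s t) => //.
  by apply/seteqP; split => x /=; rewrite !in_itv/= le_min => /andP.
- by move=> n; exists n%:R.
- apply/seteqP; split => // x _; exists (Num.truncn x).+1 => //=.
  rewrite in_itv/= ltW//; exact: Num.Theory.truncnS_gt.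
- by move=> _ [t _ <-].
Qed.

Lemma measurable_fun_esum {d} {X : measurableType d} {R : realType}
    {T : countType} (S : set T) (D : set X) (f : T -> X -> \bar R) :
  (forall i, S i -> measurable_fun D (f i)) ->
  (forall i x, S i -> D x -> (0 <= f i x)%E) ->
  measurable_fun D (fun x => (\esum_(i in S) f i x)%E).
Proof.
move=> mf f0.
pose g n x := oapp (fun i => if i \in S then f i x else 0%E) 0%E (pickle_inv n).
apply: (eq_measurable_fun (fun x => (\sum_(n <oo | n \in predT) g n x)%E)).
  move=> x /[!inE] Dx; rewrite esum_nneseries => [|i Si]; last exact: f0.
  exact: eq_eseriesl.
apply: ge0_emeasurable_sum => [n x Dx _|n _]; rewrite /g.
  case: pickle_inv => [i|] //=.
  by case: ifPn => // /[!inE] Si; exact: f0.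
case: pickle_inv => [i|] /=; last exact: measurable_cst.
have [|_] := boolP (i \in S); last exact: measurable_cst.
by rewrite inE => /mf.
Qed.

Lemma esumZl {R : realType} {T : countType} (S : set T) (c : R) (a : T -> \bar R) :
  (forall i, S i -> (0 <= a i)%E) -> 0 <= c ->
  (\esum_(i in S) (c%:E * a i) = c%:E * \esum_(i in S) a i)%E.
Proof.
move=> a0 c0; rewrite !esum_nneseries//; last first.
  by move=> i Si; rewrite mule_ge0// a0.
rewrite -nneseriesZl; last first.
  move=> n _; case: pickle_inv => [i|] //=.
  by case: ifPn => // /[!inE]; exact: a0.
apply: eq_eseriesr => n _; case: pickle_inv => [i|] /=; last by rewrite mule0.
by case: ifPn; rewrite ?mule0.
Qed.

(** If some [a i0] is positive, then [c i0] is the least cost and every index used by [a] has that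
    same cost. The left side is thus at most [c i0] times the common total, and the right side at
    least that. If no [a i] is positive, the left side is 0. *)
Lemma esum_cost_minimizer_le {R : realType} {T : countType} (S : set T)
    (c a b : T -> R) :
  (forall i, S i -> 0 <= c i) -> (forall i, S i -> 0 <= a i) ->
  (forall i, S i -> 0 <= b i) ->
  (\esum_(i in S) (a i)%:E = \esum_(i in S) (b i)%:E)%E ->
  (forall i j, S i -> S j -> 0 < a i -> c i <= c j) ->
  (\esum_(i in S) (c i * a i)%:E <= \esum_(i in S) (c i * b i)%:E)%E.
Proof.
move=> c0 a0 b0 ab opt.
have [[i0 [Si0 ai0]]|noa] := pselect (exists i, S i /\ 0 < a i); last first.
  rewrite esum1.
    by apply: esum_ge0 => i Si; rewrite lee_fin mulr_ge0 ?c0 ?b0.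
  move=> i Si; have := a0 i Si; rewrite le_eqVlt => /orP[/eqP <-|ai].
    by rewrite mulr0.
  by case: noa; exists i.
apply: (@le_trans _ _ ((c i0)%:E * \esum_(i in S) (b i)%:E)%E).
  rewrite -ab -esumZl ?c0//; apply: le_esum => i Si.
  rewrite -EFinM lee_fin; have := a0 i Si; rewrite le_eqVlt => /orP[/eqP <-|ai].
    by rewrite !mulr0.
  by rewrite ler_wpM2r ?a0// opt.
rewrite -esumZl ?c0//; apply: le_esum => i Si.
by rewrite -EFinM lee_fin ler_wpM2r ?b0// opt.
Qed.

Lemma esum_partition {R : realType} {T : choiceType} {I : finType} (S : set T)
    (k : T -> I) (a : T -> \bar R) : (forall j, S j -> (0 <= a j)%E) ->
  (\esum_(j in S) a j = \sum_(i : I) \esum_(j in [set j | S j /\ k j = i]) a j)%E.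
Proof.
move=> a0; under eq_bigr do rewrite esum_mkcondr.
rewrite -esum_sum; last first.
  by move=> j i Sj _; case: ifPn => // _; exact: a0.
apply: eq_esum => j Sj; rewrite (bigD1 (k j))//= mem_set// big1 ?adde0// => i ikj.
by rewrite memNset// => /esym/eqP; exact/negP.
Qed.

Lemma ae_forall_countable {d} {X : measurableType d} {R : realType}
    (mu : {measure set X -> \bar R}) {T : countType} (P : T -> X -> Prop) :
  (forall i, {ae mu, forall x, P i x}) -> {ae mu, forall x i, P i x}.
Proof.
move=> aeP; have : {ae mu, forall x n, oapp (P^~ x) True (@pickle_inv T n)}.
  apply: ae_foralln => n; case: pickle_inv => [i|] //=.
  exact: nearW.
by apply: filterS => x Px i; have := Px (pickle i); rewrite pickleK_inv.
Qed.

(** Precomposition with the clamp onto the interval extends [f] to a nondecreasing function on the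
    whole line. *)
Lemma nondecreasing_in_measurable {R : realType} (a b : R) (f : R -> R) :
  {in `[a, b] &, {homo f : x y / x <= y}} -> measurable_fun `[a, b]%classic f.
Proof.
move=> ndf; have [ab|ba] := leP a b; last first.
  rewrite set_itv_ge -?leNgt ?bnd_simp -?ltNge//; exact: measurable_fun_set0.
have clamp_itv x : Num.max a (Num.min b x) \in `[a, b].
  by rewrite in_itv/= le_max lexx ge_max ab ge_min lexx.
apply: (eq_measurable_fun (fun x => f (Num.max a (Num.min b x)))).
  move=> x /[!inE]/=; rewrite in_itv/= => /andP[ax xb].
  by rewrite (min_idPr xb) (max_idPr ax).
apply: nondecreasing_measurable => //= x y xy; apply: ndf => //.
by rewrite le_max2 ?le_min2.
Qed.

(** * Arrival times and induced flows *)

Section arrival_times.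
Context {R : realType} (N : model R).
Local Notation mu := (@lebesgue_measure R).
Local Notation W := (seq (E N) * I N)%type.

Lemma HsP t : Hs N t <-> 0 <= t <= tf N.
Proof. by rewrite /Hs/= in_itv. Qed.

Lemma measurable_Hs : measurable (Hs N).
Proof. exact: measurable_itv. Qed.

Lemma isLp_measurable f : isLp N f -> measurable_fun (Hs N) f.
Proof. by move=> [_ /measurable_int/measurable_EFinP]. Qed.

Lemma arrS (Tf : E N -> R -> R) e0 w k t : (k < size w)%N ->
  arr N Tf w k.+1 t = Tf (nth e0 w k) (arr N Tf w k t).
Proof. by move=> kw; rewrite /arr (take_nth e0)// foldl_rcons. Qed.

Lemma arr0 (Tf : E N -> R -> R) w t : arr N Tf w 0 t = t.
Proof. by rewrite /arr take0. Qed.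

(** Traversal times are controlled on the horizon only, so properties of [Tf] propagate along a walk
    only as long as arrival times remain there. *)
Definition stays_in_horizon (Tf : E N -> R -> R) (w : seq (E N)) :=
  forall k t, (k <= size w)%N -> Hs N t -> Hs N (arr N Tf w k t).

Lemma measurable_arr Tf w k :
  (forall e, {in Hs N &, {homo Tf e : x y / x <= y}}) ->
  stays_in_horizon Tf w -> (k <= size w)%N ->
  measurable_fun (Hs N) (arr N Tf w k).
Proof.
move=> ndT st kw; apply: nondecreasing_in_measurable.
elim: k kw => [|k IH] kw x y xH yH xy; first by rewrite !arr0.
(* A position below the length makes the walk nonempty, and its first edge serves as the default
   value of [nth]. *)
case: w kw => [//|e w] kw in st IH *.
rewrite !(arrS _ e)//; apply: ndT; last exact: IH (ltnW kw) _ _ xH yH xy.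
- by rewrite inE; apply: st => //; exact: ltnW.
- by rewrite inE; apply: st => //; exact: ltnW.
Qed.

Lemma eq_arr Tf Tf' w k t : (forall e s, Hs N s -> Tf e s = Tf' e s) ->
  stays_in_horizon Tf w -> (k <= size w)%N -> Hs N t ->
  arr N Tf w k t = arr N Tf' w k t.
Proof.
move=> TT st + Ht; elim: k => [|k IH] kw; first by rewrite !arr0.
case: w kw => [//|e w] kw in st IH *.
rewrite !(arrS _ e)// TT; last by apply: st => //; exact: ltnW.
by rewrite IH// ltnW.
Qed.

(** Grouping the positions of the walk by the edge found there gives the toll the shape of the sums
    in [induced], so that tolls can be treated one edge at a time. *)
Lemma tollsumE Tf p w t : tollsum N Tf p w t =
  \sum_(e : E N) \sum_(k < size w | nth e w k == e) p e (arr N Tf w k t).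
Proof.
elim: w t => [|e0 w IH] t /=; first by rewrite big1// => e _; rewrite big_ord0.
under eq_bigr do rewrite big_mkcond big_ord_recl/= arr0 -big_mkcond.
rewrite big_split/= IH; congr (_ + _).
by rewrite -big_mkcond/= (big_pred1 e0)// => e; rewrite eq_sym.
Qed.

(** Turns the mass that an image measure gives to a ray into an integral as in [induced]. A
    distribution function has any real argument [t], whereas [induced] speaks of levels in the
    horizon; [s] is a level there that cuts off the same values of [phi]. *)
Lemma integral_Hs_below (phi f : R -> R) (s t : R) :
  (forall x, Hs N x -> (phi x <= t) = (phi x <= s)) ->
  (forall x, Hs N x -> 0 <= phi x) ->
  (\int[mu]_(x in Hs N) ((\1_(`]-oo, t]) (phi x))%:E * (f x)%:E) =
   \int[mu]_(x in [set x | Hs N x /\ (0 <= phi x <= s)%R]) (f x)%:E)%E.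
Proof.
move=> ts phi0; rewrite [LHS]integral_mkcond [RHS]integral_mkcond.
apply: eq_integral => x _; rewrite !patchE.
case: (boolP (x \in Hs N)) => xH; last first.
  by rewrite memNset// => -[]; rewrite notin_setE in xH.
rewrite inE in xH; rewrite indicE.
case: (boolP (phi x <= s)) => xs.
  rewrite [in LHS]mem_set ?mul1e; last by rewrite /= in_itv/= ts.
  by rewrite mem_set//=; split=> //; rewrite phi0.
rewrite [in LHS]memNset ?mul0e; last by rewrite /= in_itv/= ts//; exact/negP.
by rewrite memNset//= => -[_ /andP[_]]; exact/negP.
Qed.

End arrival_times.

Section induced_flows.
Context {R : realType} (N : model R).
Local Notation mu := (@lebesgue_measure R).
Local Notation W := (seq (E N) * I N)%type.

(** Pairs of a walk and a position form one countable index set, so that the double sum in [induced]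
    becomes a single sum of image measures. *)
Definition edge_visits (e : E N) : set (W * nat) :=
  Wset N `*`` (fun w => [set k | (k < size w.1)%N && (nth e w.1 k == e)]).

Lemma esum_edge_visits e (F : W -> nat -> \bar R) :
  (forall w k, Wset N w -> (k < size w.1)%N -> (0 <= F w k)%E) ->
  (\esum_(w in Wset N) \sum_(k < size w.1 | nth e w.1 k == e) F w k =
   \esum_(j in edge_visits e) F j.1 j.2)%E.
Proof.
move=> F0; rewrite /edge_visits -esum_esum; last first.
  by move=> w k Ww /= /andP[kw _]; exact: F0.
apply: eq_esum => w Ww.
pose K := [set k | (k < size w.1)%N && (nth e w.1 k == e)].
rewrite (_ : [set k | _] = `I_(size w.1) `&` [set k | nth e w.1 k == e]); last first.
  by apply/seteqP; split => k /= => [/andP|] [] // -> ->.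
rewrite esum_mkcondr esum_fset//; last 1 first.
  by move=> k /[!inE] /= kw; case: ifPn => // _; exact: F0.
rewrite -fsbig_ord big_mkcond/=; apply: eq_bigr => k _.
by rewrite mem_setE.
Qed.

(* Both sides, as functionals of [q], are integrals against finite measures on
   the line, and [induced] says that these have the same distribution function. *)
Lemma induced_integral Tf (g : E N -> R -> R) (h : W -> R -> R) e (q : R -> R) :
  0 <= tf N -> isLp N (g e) -> (forall w, Wset N w -> isLp N (h w)) ->
  (forall w, Wset N w -> stays_in_horizon N Tf w.1) ->
  (forall e, {in Hs N &, {homo Tf e : x y / x <= y}}) ->
  Defs.induced N Tf g h ->
  measurable_fun (Hs N) q -> (forall t, Hs N t -> 0 <= q t) ->
  (\int[mu]_(x in Hs N) (q x * g e x)%:E =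
   \esum_(w in Wset N) \sum_(k < size w.1 | nth e w.1 k == e)
     \int[mu]_(x in Hs N) (q (arr N Tf w.1 k x) * h w x)%:E)%E.
Proof.
move=> tf0 [g0 ig] hLp st ndT ind mq q0.
have mg : measurable_fun (Hs N) (g e) by exact: isLp_measurable.
have mHs := measurable_Hs N.
have [m1 m1E] : exists nu : {measure set R -> \bar R}, forall q : R -> \bar R,
    measurable_fun setT q -> (forall x, 0 <= q x)%E ->
    (\int[nu]_x q x = \int[mu]_(x in Hs N) (q x * (g e x)%:E))%E.
  have := @weighted_pushforward _ _ (measurableTypeR R) R R mu (Hs N) id (g e).
  by apply => //; exact: measurable_id.
have [m2 m2E] : exists nu : {measure set R -> \bar R}, forall q : R -> \bar R,
    measurable_fun setT q -> (forall x, 0 <= q x)%E ->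
    (\int[nu]_x q x = \esum_(j in edge_visits e)
      \int[mu]_(x in Hs N) (q (arr N Tf j.1.1 j.2 x) * (h j.1 x)%:E))%E.
  have := @weighted_pushforward_esum _ _ (measurableTypeR R) R R mu _
    (edge_visits e) (Hs N) (fun j => arr N Tf j.1.1 j.2) (fun j => h j.1).
  apply => //.
  - move=> [w k] [/= Ww /andP[kw _]]; apply: measurable_arr => //; first exact: st.
    exact: ltnW.
  - by move=> [w k] [/= Ww _]; apply: isLp_measurable; exact: hLp.
  - by move=> [w k] x [/= Ww _]; exact: (hLp w Ww).1.
have mI t : measurable_fun setT (fun x : R => (\1_`]-oo, t]%classic x)%:E : \bar R).
  by apply/measurable_EFinP; exact: measurable_indic.
have I0 (t x : R) : (0 <= (\1_`]-oo, t]%classic x)%:E :> \bar R)%E by rewrite lee_fin.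
have m1I t : m1 `]-oo, t]%classic =
    (\int[mu]_(x in Hs N) ((\1_`]-oo, t]%classic x)%:E * (g e x)%:E))%E.
  by rewrite -(m1E _ (mI t) (I0 t)) integral_indic// setIT.
have m2I t : m2 `]-oo, t]%classic =
    (\esum_(j in edge_visits e) \int[mu]_(x in Hs N)
      ((\1_`]-oo, t]%classic (arr N Tf j.1.1 j.2 x))%:E * (h j.1 x)%:E))%E.
  by rewrite -(m2E _ (mI t) (I0 t)) integral_indic// setIT.
have arrH j x : edge_visits e j -> Hs N x -> 0 <= arr N Tf j.1.1 j.2 x <= tf N.
  move=> [/= Ww /andP[kw _]] Hx; apply/HsP; apply: (st j.1) => //; exact: ltnW.
have m12 t : m1 `]-oo, t]%classic = m2 `]-oo, t]%classic.
  (* Below time 0 both measures vanish, since all arrival times are nonnegative. *)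
  rewrite m1I m2I; have [t0|t0] := ltP t 0.
    rewrite integral0_eq => [|x /HsP /andP[x0 _]]; last first.
      rewrite indicE memNset ?mul0e//= in_itv/=; apply/negP.
      by rewrite -ltNge (lt_le_trans t0).
    rewrite esum1// => j Sj; rewrite integral0_eq// => x Hx.
    rewrite indicE memNset ?mul0e//= in_itv/=; apply/negP.
    by rewrite -ltNge (lt_le_trans t0)//; case/andP: (arrH j x Sj Hx).
  (* Truncation at the end of the horizon loses nothing, as no arrival happens later. *)
  pose s := Num.min t (tf N).
  have Hs_s : Hs N s by apply/HsP; rewrite le_min t0 tf0 ge_min lexx orbT.
  have ts y : 0 <= y <= tf N -> (y <= t) = (y <= s).
    by move=> /andP[_ yt]; rewrite /s le_min yt andbT.
  rewrite (integral_Hs_below N id _ s); first last.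
  - by move=> x /HsP/andP[].
  - by move=> x /HsP /ts.
  rewrite (_ : [set x | _] = Iv s); last first.
    apply/seteqP; split => x; rewrite /Iv /= in_itv/=; [by case|move=> xs].
    split=> //; apply/HsP; case/andP: xs => -> /le_trans -> //.
    by rewrite ge_min lexx orbT.
  rewrite ind// (esum_edge_visits e (fun w k => \int[mu]_(x in
    [set x | Hs N x /\ (0 <= arr N Tf w.1 k x <= s)%R]) (h w x)%:E))%E; last first.
    move=> w k Ww kw; apply: integral_ge0 => x [Hx _].
    by rewrite lee_fin; exact: (hLp w Ww).1.
  apply: eq_esum => j Sj; rewrite (integral_Hs_below N _ _ s)//.
  - by move=> x /(arrH j x Sj)/ts.
  - by move=> x /(arrH j x Sj)/andP[].
(* The mass is bounded by the total flow on the edge, which is integrable. *)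
have m1y t : (m1 `]-oo, t]%classic < +oo)%E.
  rewrite m1I; apply: (@le_lt_trans _ _ (\int[mu]_(x in Hs N) (g e x)%:E)%E).
    apply: ge0_le_integral => //.
    - by move=> x Hx; rewrite mule_ge0// lee_fin g0.
    - apply: emeasurable_funM; last exact/measurable_EFinP.
      exact: (measurable_funTS (mI t)).
    - exact/measurable_EFinP.
    - by move=> x Hx; rewrite -[leRHS]mul1e lee_wpmul2r ?lee_fin ?g0//.
  by apply: (integrable_lty _ ig).
(* The measures live on the whole line, so [q] is extended by 0 outside the horizon. *)
pose Q : R -> \bar R := (EFin \o q) \_ (Hs N).
have mQ : measurable_fun setT Q.
  by apply/(measurable_restrictT _ mHs)/measurable_EFinP.
have Q0 x : (0 <= Q x)%E.
  by rewrite /Q patchE; case: ifPn => // /[!inE] Hx; rewrite lee_fin q0.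
have QE x : Hs N x -> Q x = (q x)%:E by move=> Hx; rewrite /Q patchE mem_set.
rewrite (esum_edge_visits e
  (fun w k => \int[mu]_(x in Hs N) (q (arr N Tf w.1 k x) * h w x)%:E))%E; last first.
  move=> w k Ww kw; apply: integral_ge0 => x Hx.
  rewrite lee_fin mulr_ge0// ?q0//; last exact: (hLp w Ww).1.
  by apply: st => //; exact: ltnW.
transitivity (\int[m1]_x Q x)%E.
  by rewrite m1E//; apply: eq_integral => x /[!inE] Hx; rewrite /= QE.
rewrite (eq_integral_cumulative m1 m2 m12 m1y) m2E//.
apply: eq_esum => j Sj; apply: eq_integral => x /[!inE] Hx.
by rewrite QE//; apply/HsP; exact: arrH.
Qed.

(** Testing [induced_integral] with indicators shows that both flows have the same integral over
    every measurable part of the horizon, namely a sum that involves only [h] and [Tf]. *)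
Lemma induced_unique Tf (g g' : E N -> R -> R) (h : W -> R -> R) :
  0 <= tf N -> edgeflow N g -> edgeflow N g' ->
  (forall w, Wset N w -> isLp N (h w)) ->
  (forall w, Wset N w -> stays_in_horizon N Tf w.1) ->
  (forall e, {in Hs N &, {homo Tf e : x y / x <= y}}) ->
  Defs.induced N Tf g h -> Defs.induced N Tf g' h -> forall e, aeeq N (g e) (g' e).
Proof.
move=> tf0 gLp gLp' hLp st ndT ig ig' e.
have mHs := measurable_Hs N.
suff : ae_eq mu (Hs N) (EFin \o g e) (EFin \o g' e).
  by apply: filterS => x gg' /gg'[].
apply: integral_ae_eq => //.
- exact: (gLp e).2.
- by apply/measurable_EFinP; apply: isLp_measurable; exact: gLp'.
move=> A AH mA.
have mI : measurable_fun (Hs N) (\1_A : R -> R) by exact: measurable_funTS.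
have I0 t : Hs N t -> 0 <= \1_A t :> R by [].
have AE (f : R -> R) : (\int[mu]_(x in A) (f x)%:E =
    \int[mu]_(x in Hs N) (\1_A x * f x)%:E)%E.
  rewrite [LHS]integral_mkcond [RHS]integral_mkcond; apply: eq_integral => x _.
  rewrite !patchE indicE; case: (boolP (x \in A)) => xA.
    by rewrite mem_set ?mul1r//; apply: AH; rewrite inE in xA.
  by rewrite mul0r if_same.
rewrite !AE (induced_integral Tf g h)// (induced_integral Tf g' h)//.
Qed.

End induced_flows.

(** * Costs and tolls *)

Section total_costs.
Context {R : realType} (N : model R).
Local Notation mu := (@lebesgue_measure R).
Local Notation W := (seq (E N) * I N)%type.

Lemma ae_lebesgue_filter : Filter (nbhs (almost_everywhere mu)).
Proof. exact: (ae_filter_ringOfSetsType (T := measurableTypeR R)). Qed.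

Definition splits_rates (h : W -> R -> R) :=
  forall i, {ae mu, forall t, Hs N t ->
    (\esum_(w in [set w | Wset N w /\ w.2 = i]) (h w t)%:E = (rate N i t)%:E)%E}.

(** Exchanging sum and integral reduces the claim to almost every single time, where it is
    [esum_cost_minimizer_le] for each commodity, both flows having the total [rate N i t]. *)
Lemma total_cost_le (c a b : W -> R -> R) :
  (forall w, Wset N w -> measurable_fun (Hs N) (c w)) ->
  (forall w t, Wset N w -> Hs N t -> 0 <= c w t) ->
  (forall w, Wset N w -> isLp N (a w)) -> (forall w, Wset N w -> isLp N (b w)) ->
  splits_rates a -> splits_rates b ->
  (forall w, Wset N w -> {ae mu, forall t, Hs N t -> 0 < a w t ->
     forall w', Wset N w' -> w'.2 = w.2 -> c w t <= c w' t}) ->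
  (\esum_(w in Wset N) \int[mu]_(t in Hs N) (c w t * a w t)%:E <=
   \esum_(w in Wset N) \int[mu]_(t in Hs N) (c w t * b w t)%:E)%E.
Proof.
move=> mc c0 aLp bLp ra rb opt.
have mHs := measurable_Hs N; have aeF := ae_lebesgue_filter.
have mM f : (forall w, Wset N w -> isLp N (f w)) ->
    forall w, Wset N w -> measurable_fun (Hs N) (fun t => (c w t * f w t)%:E).
  move=> fLp w Ww; apply/measurable_EFinP; apply: measurable_funM; first exact: mc.
  by apply: isLp_measurable; exact: fLp.
have M0 f : (forall w, Wset N w -> isLp N (f w)) ->
    forall w t, Wset N w -> Hs N t -> (0 <= (c w t * f w t)%:E)%E.
  by move=> fLp w t Ww Ht; rewrite lee_fin mulr_ge0 ?c0//; exact: (fLp w Ww).1.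
rewrite -!integral_esum//; [|exact: mM|exact: M0|exact: mM|exact: M0].
apply: ae_ge0_le_integral => //.
- by move=> t Ht; apply: esum_ge0 => w Ww; exact: M0.
- by apply: measurable_fun_esum; [exact: mM|exact: M0].
- by move=> t Ht; apply: esum_ge0 => w Ww; exact: M0.
- by apply: measurable_fun_esum; [exact: mM|exact: M0].
(* Each walk has its own exceptional null set; as there are countably many walks, one null set
   serves them all. *)
have aeopt : {ae mu, forall t w, Wset N w -> Hs N t -> 0 < a w t ->
    forall w', Wset N w' -> w'.2 = w.2 -> c w t <= c w' t}.
  apply: ae_forall_countable => w; have [Ww|nWw] := pselect (Wset N w).
    by have := opt w Ww; apply: filterS => t optt _.
  exact: nearW.
have aera := ae_forall_countable _ _ ra.
have aerb := ae_forall_countable _ _ rb.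
apply: filterS3 aeopt aera aerb => t optt rat rbt Ht.
rewrite !(esum_partition (Wset N) snd); last 2 first.
- by move=> w Ww; exact: M0.
- by move=> w Ww; exact: M0.
apply: lee_sum => i _; apply: esum_cost_minimizer_le.
- by move=> w [Ww _]; exact: c0.
- by move=> w [Ww _]; exact: (aLp w Ww).1.
- by move=> w [Ww _]; exact: (bLp w Ww).1.
- by rewrite rat// rbt.
- by move=> w w' [Ww wi] [Ww' wi'] aw; apply: optt => //; rewrite wi wi'.
Qed.

Lemma measurable_comp_arr Tf (q : R -> R) w k : measurable_fun (Hs N) q ->
  (forall e, {in Hs N &, {homo Tf e : x y / x <= y}}) ->
  stays_in_horizon N Tf w -> (k <= size w)%N ->
  measurable_fun (Hs N) (fun t => q (arr N Tf w k t)).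
Proof.
move=> mq ndT st kw; apply: (measurable_comp (F := Hs N)) => //.
- exact: measurable_Hs.
- by move=> _ [t Ht <-]; exact: st.
- exact: measurable_arr.
Qed.

Lemma measurable_tollsum Tf p w :
  (forall e, measurable_fun (Hs N) (p e)) ->
  (forall e, {in Hs N &, {homo Tf e : x y / x <= y}}) ->
  stays_in_horizon N Tf w -> measurable_fun (Hs N) (tollsum N Tf p w).
Proof.
move=> mp ndT st.
apply: (eq_measurable_fun (fun t => \sum_(e : E N) \sum_(k < size w)
    (if nth e w k == e then p e (arr N Tf w k t) else 0))).
  by move=> t _; rewrite tollsumE; apply: eq_bigr => e _; rewrite -big_mkcond.
apply: measurable_sum => e; apply: measurable_sum => k.
case: (_ == e); last exact: measurable_cst.
by apply: measurable_comp_arr => //; exact: ltnW.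
Qed.

Lemma tollsum_ge0 Tf p w t : (forall e s, Hs N s -> 0 <= p e s) ->
  stays_in_horizon N Tf w -> Hs N t -> 0 <= tollsum N Tf p w t.
Proof.
move=> p0 st Ht; rewrite tollsumE; apply: sumr_ge0 => e _; apply: sumr_ge0 => k _.
by apply/p0/st => //; exact: ltnW.
Qed.

(** The toll revenue counted by walks equals the revenue counted by edges: [induced_integral] with
    [q] the toll of one edge, summed over the edges. *)
Lemma integral_toll Tf (p g : E N -> R -> R) (h : W -> R -> R) :
  0 <= tf N -> tolls N p -> edgeflow N g -> (forall w, Wset N w -> isLp N (h w)) ->
  (forall w, Wset N w -> stays_in_horizon N Tf w.1) ->
  (forall e, {in Hs N &, {homo Tf e : x y / x <= y}}) ->
  Defs.induced N Tf g h ->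
  (\esum_(w in Wset N) \int[mu]_(t in Hs N) (tollsum N Tf p w.1 t * h w t)%:E =
   \sum_(e : E N) \int[mu]_(t in Hs N) (p e t * g e t)%:E)%E.
Proof.
move=> tf0 tp gLp hLp st ndT ind.
pose F e (w : W) (k : nat) t := (p e (arr N Tf w.1 k t) * h w t)%:E.
have F0 e w k t : Wset N w -> (k < size w.1)%N -> Hs N t -> (0 <= F e w k t)%E.
  move=> Ww kw Ht; rewrite lee_fin mulr_ge0//; last exact: (hLp w Ww).1.
  by apply/(tp e).2/st => //; exact: ltnW.
transitivity (\sum_(e : E N) \esum_(w in Wset N)
    \sum_(k < size w.1 | nth e w.1 k == e) \int[mu]_(t in Hs N) F e w k t)%E; last first.
  apply: eq_bigr => e _; rewrite (induced_integral N Tf g h)//.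
  - exact: (tp e).1.
  - exact: (tp e).2.
rewrite -esum_sum; last first.
  move=> w e Ww _; apply: sume_ge0 => k _; apply: integral_ge0 => t Ht.
  exact: F0.
apply: eq_esum => w Ww.
(* The condition on the position moves into the summand, so that sum and integral are exchanged over
   all positions. *)
pose G e (k : 'I_(size w.1)) t : \bar R := if nth e w.1 k == e then F e w k t else 0%E.
have mG e k : measurable_fun (Hs N) (G e k).
  rewrite /G; case: (_ == e); last exact: measurable_cst.
  apply/measurable_EFinP; apply: measurable_funM; last by apply: isLp_measurable; exact: hLp.
  apply: measurable_comp_arr => //; [exact: (tp e).1|exact: st|exact: ltnW].
have G0 e k t : Hs N t -> (0 <= G e k t)%E.
  by rewrite /G; case: ifPn => // _ Ht; exact: F0.
transitivity (\int[mu]_(t in Hs N) (\sum_(e : E N) \sum_(k < size w.1) G e k t))%E.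
  apply: eq_integral => t _; rewrite tollsumE mulr_suml -sumEFin.
  by apply: eq_bigr => e _; rewrite mulr_suml -sumEFin big_mkcond.
have mHs := measurable_Hs N.
rewrite ge0_integral_sum//.
- apply: eq_bigr => e _; rewrite ge0_integral_sum//; [|exact: mG|exact: G0].
  rewrite [RHS]big_mkcond; apply: eq_bigr => k _.
  by rewrite /G; case: (_ == e) => //; rewrite integral0.
- by move=> e; apply: emeasurable_sum; exact: mG.
- by move=> e t Ht; apply: sume_ge0 => k _; exact: G0.
Qed.

End total_costs.

(** * The equilibrium under the fixed travel times of [u] *)

Section equilibrium_flow.
Context {R : realType} (N : model R).
Local Notation mu := (@lebesgue_measure R).
Local Notation W := (seq (E N) * I N)%type.

(** Serves to pass from the traversal times of [ell N h] to those of [u]: if they agree on the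
    horizon, so do all arrival times, and the sets of departure times in [induced] are the same. *)
Lemma eq_induced Tf Tf' (g : E N -> R -> R) (h : W -> R -> R) :
  (forall e t, Hs N t -> Tf e t = Tf' e t) ->
  (forall w, Wset N w -> stays_in_horizon N Tf w.1) ->
  Defs.induced N Tf g h -> Defs.induced N Tf' g h.
Proof.
move=> TT st ind e t Ht; rewrite ind//; apply: eq_esum => w Ww.
apply: eq_bigr => k _; congr integral; apply/seteqP.
have arrE x : Hs N x -> arr N Tf w.1 k x = arr N Tf' w.1 k x.
  by move=> Hx; apply: eq_arr => //; [exact: st|exact: ltnW].
by split => x /= [Hx]; [rewrite arrE|rewrite -arrE].
Qed.

(** Makes the travel cost [Psi] nonnegative. *)
Lemma arr_ge Tf w k t : (forall e s, Hs N s -> s <= Tf e s) ->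
  stays_in_horizon N Tf w -> (k <= size w)%N -> Hs N t -> t <= arr N Tf w k t.
Proof.
move=> Tge st + Ht; elim: k => [|k IH] kw; first by rewrite arr0.
case: w kw => [//|e w] kw in st IH *.
rewrite (arrS _ _ e)//; apply: le_trans (IH (ltnW kw)) _.
by apply/Tge/st => //; exact: ltnW.
Qed.

End equilibrium_flow.

Theorem theorem3p1 (R : realType) (N : model R) :
  setting N -> well_defined N -> standing_assumptions N ->
  forall u : Defs.E N -> R -> R,
    (exists2 h0, Lambda N h0 & u = ell N h0) ->
    (exists p h, tolls N p /\ implementable N u p h) ->
    exists h', [/\ master_feasible N u h',
                   (forall h'', master_feasible N u h'' ->
                      (master_obj N u h' <= master_obj N u h'')%E) &
                   forall e, aeeq N (ellu N u h' e) (u e)].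
Proof.
move=> [_ [tf'0 tf'tf] gam0 _ _] [D0 Dae ellP elluP] [[taumin _ A1] _ A3 _].
move=> u [h0 Lh0 uE] [p [h [tp [[Lh opt] ellhu pfin]]]].
have tf0 : 0 <= tf N by exact: le_trans tf'0 (ltW tf'tf).
have mHs := measurable_Hs N; have aeF := @ae_lebesgue_filter R.
have uLp : edgeflow N u by rewrite uE; have [] := ellP h0 Lh0.
(* Assumption 3 covers only loaded flows; it reaches [u] through [u = ell N h0]. *)
have st w : Wset N w -> stays_in_horizon N (Tt N u) w.1.
  by move=> Ww k t kw Ht; rewrite uE; exact: A3.
have ndT e : {in Hs N &, {homo Tt N u e : x y / x <= y}}.
  by have [] := A1 u e uLp.
have [ellLp ells elli] := ellP h Lh.
(* [ell N h] and [u] agree only almost everywhere, but their traversal times agree at every time of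
   the horizon by [well_defined]. *)
have TE e t : Hs N t -> Tt N (ell N h) e t = Tt N u e t.
  by move=> Ht; rewrite /Tt (Dae (ell N h) u).
have sth w : Wset N w -> stays_in_horizon N (Tt N (ell N h)) w.1.
  by move=> Ww k t kw Ht; exact: A3.
have indh : Defs.induced N (Tt N u) (ell N h) h := eq_induced N _ _ _ _ TE sth elli.
have [hLp hfin hrate _] := Lh.
have Luh : Lambdau N u h by split => //; exists (ell N h).
have [elluLp _ ellui] := elluP u h uLp Luh.
(* [ellu N u h] and [ell N h] are both induced by [h] under the traversal times of [u], hence agree
   almost everywhere. *)
have elluu e : aeeq N (ellu N u h e) (u e).
  have := induced_unique N (Tt N u) _ _ h tf0 elluLp ellLp hLp st ndT ellui indh e.
  by move=> ae1; apply: filterS2 ae1 (ellhu e) => t e1 e2 Ht; rewrite e1// e2.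
exists h; split => //.
  by split => // e; apply: filterS (elluu e) => t + Ht => ->.
move=> h'' [Luh'' le_u].
have [h''Lp _ h''rate _] := Luh''.
have [ellu''Lp _ ellu''i] := elluP u h'' uLp Luh''.
pose c (w : seq (Defs.E N) * Defs.I N) t := Psi N u w t + Ptoll N p u w t.
have Psi0 w t : Wset N w -> Hs N t -> 0 <= Psi N u w t.
  move=> Ww Ht; apply: mulr_ge0; first exact/ltW/gam0.
  rewrite subr_ge0 arr_ge//; [|exact: st].
  by move=> e s Hs_s; rewrite /Tt lerDl D0.
have toll0 w t : Wset N w -> Hs N t -> 0 <= Ptoll N p u w t.
  by move=> Ww Ht; apply: tollsum_ge0 => //; [move=> e; exact: (tp e).2|exact: st].
have mPsi w : Wset N w -> measurable_fun (Hs N) (Psi N u w).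
  move=> Ww; apply: measurable_funM; first exact: measurable_cst.
  apply: measurable_funB; last exact: measurable_id.
  by apply: measurable_arr => //; exact: st.
have mtoll w : Wset N w -> measurable_fun (Hs N) (Ptoll N p u w).
  by move=> Ww; apply: measurable_tollsum => //; [move=> e; exact: (tp e).1|exact: st].
have Psi_ell w t : Wset N w -> Hs N t -> Psi N (ell N h) w t = Psi N u w t.
  by move=> Ww Ht; rewrite /Psi (eq_arr N _ _ _ _ _ TE (sth w Ww)).
have toll_ell w t : Wset N w -> Hs N t -> Ptoll N p (ell N h) w t = Ptoll N p u w t.
  move=> Ww Ht; rewrite /Ptoll !tollsumE; apply: eq_bigr => e _.
  by apply: eq_bigr => k _; rewrite (eq_arr N _ _ _ _ _ TE (sth w Ww))// ltnW.
have le_c : (\esum_(w in Wset N) \int[lebesgue_measure]_(t in Hs N) (c w t * h w t)%:E <=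
    \esum_(w in Wset N) \int[lebesgue_measure]_(t in Hs N) (c w t * h'' w t)%:E)%E.
  apply: total_cost_le => //.
  - by move=> w Ww; apply: measurable_funD; [exact: mPsi|exact: mtoll].
  - by move=> w t Ww Ht; rewrite addr_ge0 ?Psi0 ?toll0.
  - move=> w Ww; apply: filterS (opt w Ww) => t optt Ht hw w' Ww' ww'.
    by have := optt Ht hw w' Ww' ww'; rewrite !Psi_ell// !toll_ell.
(* Travel costs and tolls are nonnegative, so their totals may be separated even when infinite. *)
have split_c (f : seq (Defs.E N) * Defs.I N -> R -> R) :
    (forall w, Wset N w -> isLp N (f w)) ->
    (\esum_(w in Wset N) \int[lebesgue_measure]_(t in Hs N) (c w t * f w t)%:E =
     master_obj N u f + \esum_(w in Wset N)
       \int[lebesgue_measure]_(t in Hs N) (tollsum N (Tt N u) p w.1 t * f w t)%:E)%E.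
  move=> fLp; rewrite -esumD.
  - apply: eq_esum => w Ww; rewrite -ge0_integralD//.
    + by apply: eq_integral => t _; rewrite -EFinD -mulrDl.
    + by move=> t Ht; rewrite lee_fin mulr_ge0 ?Psi0//; exact: (fLp w Ww).1.
    + apply/measurable_EFinP; apply: measurable_funM; first exact: mPsi.
      by apply: isLp_measurable; exact: fLp.
    + by move=> t Ht; rewrite lee_fin mulr_ge0 ?toll0//; exact: (fLp w Ww).1.
    + apply/measurable_EFinP; apply: measurable_funM; first exact: mtoll.
      by apply: isLp_measurable; exact: fLp.
  - move=> w Ww; apply: integral_ge0 => t Ht.
    by rewrite lee_fin mulr_ge0 ?Psi0//; exact: (fLp w Ww).1.
  - move=> w Ww; apply: integral_ge0 => t Ht.
    by rewrite lee_fin mulr_ge0 ?toll0//; exact: (fLp w Ww).1.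
have mpg (g : Defs.E N -> R -> R) e : edgeflow N g ->
    measurable_fun (Hs N) (fun t => (p e t * g e t)%:E).
  move=> gLp; apply/measurable_EFinP; apply: measurable_funM; first exact: (tp e).1.
  by apply: isLp_measurable; exact: gLp.
have pg0 (g : Defs.E N -> R -> R) e t : edgeflow N g -> Hs N t ->
    (0 <= (p e t * g e t)%:E)%E.
  by move=> gLp Ht; rewrite lee_fin mulr_ge0 ?(tp e).2//; exact: (gLp e).1.
pose K := (\sum_(e : Defs.E N) \int[lebesgue_measure]_(t in Hs N) (p e t * u e t)%:E)%E.
have Kfin : K \is a fin_num.
  rewrite ge0_fin_numE//; apply: sume_ge0 => e _; apply: integral_ge0 => t Ht.
  exact: pg0.
(* Adding the finite amount [K] to both sides leaves the chain: cost of [h] plus [K], at most cost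
   plus tolls of [h''], at most cost of [h''] plus [K]. *)
rewrite -(leeD2rE _ _ Kfin).
have tollh : (\esum_(w in Wset N) \int[lebesgue_measure]_(t in Hs N)
    (tollsum N (Tt N u) p w.1 t * h w t)%:E = K)%E.
  rewrite (integral_toll N _ _ _ _ tf0 tp ellLp hLp st ndT indh).
  apply: eq_bigr => e _; apply: ae_eq_integral => //; [exact: mpg|exact: mpg|].
  by apply: filterS (ellhu e) => t eut Ht; rewrite eut.
(* The tolls of [h''] are collected on [ellu N u h''], which feasibility bounds by [u]; tolls being
   nonnegative, the revenue is at most [K]. *)
have tollh'' : (\esum_(w in Wset N) \int[lebesgue_measure]_(t in Hs N)
    (tollsum N (Tt N u) p w.1 t * h'' w t)%:E <= K)%E.
  rewrite (integral_toll N _ _ _ _ tf0 tp ellu''Lp h''Lp st ndT ellu''i).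
  apply: lee_sum => e _; apply: ae_ge0_le_integral => //.
  - by move=> t; exact: pg0.
  - exact: mpg.
  - by move=> t; exact: pg0.
  - exact: mpg.
  - apply: filterS (le_u e) => t leut Ht; rewrite lee_fin ler_wpM2l ?(tp e).2//.
    exact: leut.
move: le_c; rewrite !split_c// tollh => /le_trans; apply.
by rewrite leeD2l.
Qed.
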